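(* Let $k\ge 2$ and $n>3k-3$ be integers. Then there is no graph in $\mathfrak{Gr}(n,k)$. In other words, $\Xi(k)\le 3k-3$ for $k\ge 2$.
   Context: All graphs are finite, simple and undirected. For a graph $G=(V,E)$ and $x\in V$, $N[x]=\{x\}\cup\{y: xy\in E\}$. A set $C\subseteq V$ is identifying if $N[x]\cap C\ne\emptyset$ for every $x\in V$ and $N[x]\cap C\neq N[y]\cap C$ for all distinct $x,y\in V$. For $n\ge k\ge1$, $\mathfrak{Gr}(n,k)$ is the set of graphs on $n$ vertices in which every $k$-element subset of vertices is identifying, and $\Xi(k)=\max\{n\ge k:\mathfrak{Gr}(n,k)\ne\emptyset\}$. *)

(* Defs.v *)
From HB Require Import structures.
From mathcomp Require Import all_boot boolp.
Set Implicit Arguments.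
Unset Strict Implicit.
Unset Printing Implicit Defensive.

Record sgraph := SGraph {
  vertex :> finType;
  edge : rel vertex;
  edge_sym : symmetric edge;
  edge_irrefl : irreflexive edge }.

Definition closed_nbhd (G : sgraph) (x : G) : {set G} :=
  x |: [set y | edge x y].

Definition identifying (G : sgraph) (C : {set G}) : Prop :=
  (forall x : G, closed_nbhd x :&: C != set0) /\
  (forall x y : G, x != y -> closed_nbhd x :&: C != closed_nbhd y :&: C).

Definition Gr (n k : nat) (G : sgraph) : Prop :=
  #|G| = n /\ forall C : {set G}, #|C| = k -> identifying C.

(* The bracket `[< _ >] is classical: it makes the existence of a graph a
   boolean predicate on nat, as ex_maxn requires. *)
Definition Xi_range (k : nat) : pred nat :=
  fun n => (k <= n) && `[< exists G : sgraph, Gr n k G >].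

(* The edgeless graph on k vertices is in Gr k k. *)
Lemma Xi_range_nonempty (k : nat) : exists n, Xi_range k n.
Proof.
exists k; rewrite /Xi_range leqnn /=; apply/asboolP.
have sym0 : symmetric (fun _ _ : 'I_k => false) by [].
have irr0 : irreflexive (fun _ _ : 'I_k => false) by [].
exists (SGraph sym0 irr0); split; first by rewrite card_ord.
move=> C cardC.
have -> : C = setT.
  by apply/eqP; rewrite eqEcard subsetT cardsT card_ord cardC leqnn.
have nbhdE (x : SGraph sym0 irr0) : closed_nbhd x = [set x].
  by apply/setP => y; rewrite !inE orbF.
split=> [x|x y]; rewrite !setIT !nbhdE.
  by apply/set0Pn; exists x; rewrite inE.
by apply: contra_neq => /set1_inj.
Qed.

(* If C is identifying, then x |-> N[x] :&: C embeds the vertices into the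
   subsets of C. *)
Lemma Xi_range_bounded (k n : nat) : Xi_range k n -> n <= 2 ^ k.
Proof.
case/andP=> le_kn /asboolP [G [cardG idG]].
have [C cardC] : exists C : {set G}, #|C| = k.
  have : 0 < #|[set C : {set G} | #|C| == k]|.
    by rewrite card_draws cardG bin_gt0.
  by case/card_gt0P=> C; rewrite inE => /eqP; exists C.
have [_ sepC] := idG C cardC.
have injf : injective (fun x : G => closed_nbhd x :&: C).
  by move=> x y eqxy; apply/eqP; apply/negPn/negP=> /sepC; rewrite eqxy eqxx.
rewrite -cardG -cardC -card_powerset -(card_imset predT injf).
apply: subset_leq_card; apply/subsetP => _ /imsetP [x _ ->].
by rewrite powersetE subsetIr.
Qed.

Definition Xi (k : nat) : nat :=
  ex_maxn (Xi_range_nonempty k) (@Xi_range_bounded k).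

(* Main.v *)
(* If x and y are distinct, the vertices contained in both or in neither of
   N[x] and N[y] number at most k - 1, since any k of them would form a set
   that does not separate x from y.  Given three distinct vertices, membership
   of any vertex v in their closed neighbourhoods takes only two truth values,
   so the three pairwise agreement sets cover V, whence n <= 3(k - 1). *)
Require Import Defs.
From mathcomp Require Import all_boot boolp zify.

Definition agreement_set {G : sgraph} (x y : G) : {set G} :=
  [set v | (v \in closed_nbhd x) == (v \in closed_nbhd y)].

(** The [k]-element subsets of [A] are counted by a binomial coefficient, positive since
    [k <= #|A|]. *)
Lemma exists_subset_card {T : finType} {A : {set T}} {k : nat} :
  k <= #|A| -> exists2 C : {set T}, C \subset A & #|C| = k.
Proof.
move=> le_kA.
have : 0 < #|[set C : {set T} | (C \subset A) && (#|C| == k)]|.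
  by rewrite cards_draws bin_gt0.
by case/card_gt0P=> C; rewrite inE => /andP[sCA /eqP cardC]; exists C.
Qed.

Lemma card_agreement_set {n k : nat} {G : sgraph} {x y : G} :
  Gr n k G -> x != y -> #|agreement_set x y| < k.
Proof.
move=> [_ idG] neq_xy; rewrite ltnNge; apply/negP.
case/exists_subset_card=> C /subsetP sCA /idG [_ /(_ x y neq_xy)] /eqP; apply.
apply/setP=> v; rewrite !in_setI; case Cv: (v \in C); last by rewrite !andbF.
by have := sCA v Cv; rewrite inE => /eqP ->.
Qed.

Lemma agreement_set_cover (G : sgraph) (x y z : G) :
  agreement_set x y :|: agreement_set y z :|: agreement_set x z = setT.
Proof.
apply/setP=> v; rewrite 2!in_setU ![_ \in agreement_set _ _]in_set in_setT.
by case: (v \in _) (v \in _) (v \in _) => [] [] [].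
Qed.

Lemma Gr_leq {n k : nat} {G : sgraph} : 2 < n -> Gr n k G -> n <= 3 * k - 3.
Proof.
move=> n_gt2 GrG; have [cardG _] := GrG.
have /card_gt2P [x [y [z [_ [nxy nyz nzx]]]]] : 2 < #|G| by rewrite cardG.
have lexy := card_agreement_set GrG nxy.
have leyz := card_agreement_set GrG nyz.
have lexz : #|agreement_set x z| < k.
  by apply: card_agreement_set GrG _; rewrite eq_sym.
have [leU _] := leq_card_setU (agreement_set x y :|: agreement_set y z)
                              (agreement_set x z).
have [leU' _] := leq_card_setU (agreement_set x y) (agreement_set y z).
(* The strict bounds force [k > 0], so the truncated [3 * k - 3] is truly 3(k - 1). *)
rewrite agreement_set_cover cardsT cardG in leU; lia.
Qed.

Theorem theorem12 (k : nat) (hk : 2 <= k) :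
  (forall n : nat, 3 * k - 3 < n -> ~ exists G : sgraph, Gr n k G) /\
  Xi k <= 3 * k - 3.
Proof.
have no_Gr n : 3 * k - 3 < n -> ~ exists G : sgraph, Gr n k G.
  move=> lt_kn [G GrG].
  (* Since [k >= 2], 3k - 3 is at least 3, so three distinct vertices are available. *)
  have n_gt2 : 2 < n by lia.
  by have := leq_trans lt_kn (Gr_leq n_gt2 GrG); rewrite ltnn.
split=> //; rewrite leqNgt; apply/negP=> /no_Gr; apply.
(* The maximum is attained: some graph has exactly [Xi k] vertices. *)
by rewrite /Xi; case: ex_maxnP => n /andP[_ /asboolP].
Qed.
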